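(* Let $n\geq 3$ be a natural number and let $p$ be a partition of $n$. Then $p$ is admissible if and only if there exists a pre-meadow with $\mathbf{a}$, $M$, such that $p$ is associated with $M$.
   Context: A pre-meadow is a structure $(P,+,-,\cdot)$ with two binary operations $+,\cdot$, a unary operation $-$ and constants $0,1$, satisfying for all $x,y,z\in P$: $(x+y)+z=x+(y+z)$; $x+y=y+x$; $x+0=x$; $x+(-x)=0\cdot x$; $(x\cdot y)\cdot z=x\cdot(y\cdot z)$; $x\cdot y=y\cdot x$; $1\cdot x=x$; $x\cdot(y+z)=x\cdot y+x\cdot z$; $-(-x)=x$; $0\cdot(x+y)=0\cdot x+0\cdot y$. For a pre-meadow $P$, let $0\cdot P=\{0\cdot x\mid x\in P\}$ and, for $z\in 0\cdot P$, let $P_z=\{x\in P\mid 0\cdot x=z\}$. $P$ is a pre-meadow with $\mathbf{a}$ if there exists a unique $z\in 0\cdot P$ with $|P_z|=1$, this $z$ being denoted $\mathbf{a}$, and moreover $x+\mathbf{a}=\mathbf{a}$ for all $x\in P$. Associated partition: given a pre-meadow with $\mathbf{a}$, $M$, with $n$ elements, a partition of $n$ of the form $a_0+\cdots+a_s+1$ is associated with $M$ if there exist $x_0,\dots,x_s\in (0\cdot M)\setminus\{\mathbf{a}\}$ such that $a_i=|M_{x_i}|$ for all $i\in\{0,\dots,s\}$, and $M_{x_i}\neq M_{x_j}$ for $i\neq j$. Admissible partition: a partition of a natural number $n\geq 3$ is admissible if it is of the form $a_0+\cdots+a_s+1$ with $a_i>1$ for all $i\in\{0,\dots,s\}$, and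 there is some $k\in\{0,\dots,s\}$ such that, for every $i\in\{0,\dots,s\}$, all prime divisors of $a_i$ are also prime divisors of $a_k$. *)

(* Defs.v *)
From mathcomp Require Import all_boot.
From mathcomp Require Import classical_sets functions cardinality.

Set Implicit Arguments.
Unset Strict Implicit.
Unset Printing Implicit Defensive.

Local Open Scope classical_set_scope.
Local Open Scope card_scope.

Record preMeadow := PreMeadow {
  pm_car :> Type;
  pm_add : pm_car -> pm_car -> pm_car;
  pm_opp : pm_car -> pm_car;
  pm_mul : pm_car -> pm_car -> pm_car;
  pm_zero : pm_car;
  pm_one : pm_car;
  pm_addA : associative pm_add;
  pm_addC : commutative pm_add;
  pm_addr0 : right_id pm_zero pm_add;
  pm_addrN : forall x, pm_add x (pm_opp x) = pm_mul pm_zero x;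
  pm_mulA : associative pm_mul;
  pm_mulC : commutative pm_mul;
  pm_mul1r : left_id pm_one pm_mul;
  pm_mulDr : right_distributive pm_mul pm_add;
  pm_oppK : involutive pm_opp;
  pm_mul0D : forall x y, pm_mul pm_zero (pm_add x y) =
    pm_add (pm_mul pm_zero x) (pm_mul pm_zero y)
}.

Definition pm_zeros (P : preMeadow) : set P := range (@pm_mul P (pm_zero P)).

Definition pm_fiber (P : preMeadow) (z : P) : set P :=
  [set x | pm_mul (pm_zero P) x = z].

Record preMeadowWithA := PreMeadowWithA {
  pma_base :> preMeadow;
  pma_a : pma_base;
  pma_aP : unique (fun z => pm_zeros z /\ pm_fiber z #= `I_1) pma_a;
  pma_addra : forall x, pm_add x pma_a = pma_a
}.

(* A partition of n is unordered; it is encoded by the weakly decreasing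
   sequence of its positive parts. *)
Definition nat_partition (n : nat) (p : seq nat) : Prop :=
  [/\ sorted geq p, all (leq 1) p & sumn p = n].

(* p is of the form a_0 + ... + a_s + 1, up to the order of the parts *)
Definition partition_form (p : seq nat) (s : nat) (a : 'I_s.+1 -> nat) : Prop :=
  perm_eq p (rcons (codom a) 1).

Definition admissible (p : seq nat) : Prop :=
  exists (s : nat) (a : 'I_s.+1 -> nat),
    [/\ partition_form p a,
        forall i, 1 < a i &
        exists k, forall i q, prime q -> q %| a i -> q %| a k].

Definition associated (n : nat) (p : seq nat) (M : preMeadowWithA) : Prop :=
  [set: M] #= `I_n /\
  exists (s : nat) (a : 'I_s.+1 -> nat) (x : 'I_s.+1 -> M),
    [/\ partition_form p a,
        forall i, (@pm_zeros M `\ pma_a M) (x i),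
        forall i, pm_fiber (x i) #= `I_(a i) &
        forall i j, i != j -> pm_fiber (x i) <> pm_fiber (x j)].

(* Main.v *)
Require Import Defs.
From mathcomp Require Import all_boot.
From HB Require Import structures.
From mathcomp Require Import all_algebra all_fingroup all_solvable.
From mathcomp Require Import boolp classical_sets functions cardinality.

Set Implicit Arguments.
Unset Strict Implicit.
Unset Printing Implicit Defensive.

Import GRing.Theory.

Local Open Scope classical_set_scope.
Local Open Scope card_scope.

(** A pre-meadow is a family of commutative rings, its fibres over the elements
    of [0 * M]: the fibre of [z] has zero [z] and unit [1 + z], and
    [x |-> x + z] is a ring morphism from the fibre of [0] to it.

    From a pre-meadow to an admissible partition: the distinguished index [k]
    is the one of the fibre of [0].  It occurs among the [x_i] because these
    fibres have [n - 1] elements in all, which leaves no room for both [0] and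
    [a] outside them ([associated_zero]).  If the fibre of [0] has order [b],
    then [b] times [1] is [0] by Lagrange, so [b] annihilates every fibre.  By
    Cauchy, a prime dividing the order of a fibre then divides [b]
    ([fiber_prime_dvd]).  A part [a_i] cannot be 1 because [a] is the only
    point with a singleton fibre.

    From an admissible partition to a pre-meadow: products of prime fields
    provide a ring of each order [a_i], and the hypothesis on prime divisors
    provides a ring morphism to each of them from the ring of order [a_k]
    ([ring_of_order]).  These rings are glued along the semilattice with top
    [k], bottom [a], and the other indices pairwise incomparable in between: to
    combine two elements, map both to the meet of their indices and combine
    them there ([plonka_preMeadow]).  The fibre over the bottom is the zero
    ring, and it supplies the element [a]. *)

(** * Cardinals as injective enumerations *)

(** Turns the relational cardinals of classical sets into enumerations by a
    finite type, on which finite groups and counting are available. *)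
Lemma card_eq_enum (F : finType) (T : Type) (A : set T) :
  A #= `I_#|F| <-> exists2 g : F -> T, injective g & A = range g.
Proof.
have cF : `I_#|F| #= [set: F].
  have r_inj : injective (fun x : F => enum_rank x : nat).
    by move=> x y /val_inj/enum_rank_inj.
  rewrite (_ : `I__ = range (fun x : F => enum_rank x : nat)).
    by apply: inj_card_eq => x y _ _ /r_inj.
  apply/seteqP; split=> [i /= i_lt|_ [x _ <-]]; last exact: ltn_ord.
  by exists (enum_val (Ordinal i_lt)); rewrite // enum_valK.
rewrite (card_eqr cF); split=> [|[g g_inj ->]]; last first.
  by apply: inj_card_eq => x y _ _ /g_inj.
rewrite card_eq_sym => /card_bijP[f [f' fK f'K]].
exists (fun x => set_val (f (to_setT x))).
  by move=> x y /val_inj/(can_inj fK)/(congr1 set_val).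
apply/seteqP; split=> [y /mem_set yA|_ [x _ <-]]; last exact/set_mem/valP.
exists (set_val (f' (SigSub yA))) => //.
rewrite (_ : to_setT _ = f' (SigSub yA)) ?f'K //; exact: val_inj.
Qed.

(** * Rings of prescribed order *)

Section RingsOfOrder.
Local Open Scope ring_scope.

HB.instance Definition _ (R1 R2 : finComNzRingType) :=
  GRing.ComNzRing.on (R1 * R2)%type.

Definition pair_fun (S R1 R2 : Type) (f : S -> R1) (g : S -> R2) s :=
  (f s, g s).

Section PairMorphism.

Variables (S R1 R2 : comNzRingType).
Variables (f : {rmorphism S -> R1}) (g : {rmorphism S -> R2}).

HB.instance Definition _ :=
  GRing.isZmodMorphism.Build S (R1 * R2)%type (pair_fun f g)
    (fun x y => congr2 pair (rmorphB f x y) (rmorphB g x y)).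

HB.instance Definition _ :=
  GRing.isMonoidMorphism.Build S (R1 * R2)%type (pair_fun f g)
    (congr2 pair (rmorph1 f) (rmorph1 g),
     fun x y => congr2 pair (rmorphM f x y) (rmorphM g x y)).

End PairMorphism.

(** The ring is the product of one prime field for each prime factor of [m],
    counted with multiplicity.  The morphisms from it to the prime fields make
    the lemma apply to its own output: it is used with [S] the ring of integers
    to build the ring of order [a_k], then with that ring as [S] to build each
    of the others. *)
Lemma ring_of_order (S : comNzRingType) (m : nat) :
  (1 < m)%N ->
  (forall p, prime p -> (p %| m)%N -> inhabited {rmorphism S -> 'F_p}) ->
  exists R : finComNzRingType, [/\ #|R| = m, inhabited {rmorphism S -> R} &
    forall p, prime p -> (p %| m)%N -> inhabited {rmorphism R -> 'F_p}].
Proof.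
elim/ltn_ind: m => m IH m_gt1 toF.
have q_pr : prime (pdiv m) by apply: pdiv_prime.
have q_m := pdiv_dvd m; set q := pdiv m in q_pr q_m.
have [f] := toF q q_pr q_m.
have Em : m = (q * (m %/ q))%N by rewrite mulnC divnK.
have [->|m_neq_q] := eqVneq m q.
  exists 'F_q; split; [by rewrite card_Fp | by exists |].
  move=> p p_pr; rewrite dvdn_prime2 // => /eqP ->.
  exact: (inhabits (idfun : {rmorphism 'F_q -> 'F_q})).
have d_gt1 : (1 < m %/ q)%N.
  rewrite ltn_neqAle divn_gt0 ?prime_gt0 // dvdn_leq ?(ltnW m_gt1) // andbT.
  by apply: contra_neq m_neq_q => d1; rewrite Em -d1 muln1.
have d_lt : (m %/ q < m)%N by rewrite ltn_Pdiv ?prime_gt1 ?(ltnW m_gt1).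
have [p p_pr p_d|R [cR [g] RtoF]] := IH _ d_lt d_gt1.
  by apply: toF => //; rewrite Em dvdn_mull.
exists ('F_q * R)%type; split; first by rewrite card_prod card_Fp // cR -Em.
  exact: (inhabits (pair_fun f g : {rmorphism S -> 'F_q * R})).
move=> p p_pr; rewrite Em Euclid_dvdM // dvdn_prime2 //.
move=> /orP[/eqP->|/RtoF[//|h]].
  exact: (inhabits (fst : {rmorphism 'F_q * R -> 'F_q})).
exact: (inhabits (h \o snd : {rmorphism 'F_q * R -> 'F_p})).
Qed.

End RingsOfOrder.

(** * Gluing rings below a common one *)

Section PlonkaSum.
Local Open Scope ring_scope.

Variables (S : finComNzRingType) (I : finType) (R : I -> finComNzRingType).
Variable h : forall i, {rmorphism S -> R i}.

(** [None] is the element of the zero ring at the bottom of the semilattice;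
    the whole is the Plonka sum of the rings [S], [R i] and zero. *)
Definition plonka : finType := option (S + {i & R i}).
Definition pl_top (x : S) : plonka := Some (inl x).
Definition pl_mid i (y : R i) : plonka := Some (inr (Tagged R y)).

(** Addition and multiplication differ only by the ring operation applied after
    both arguments have been mapped to the meet of their indices, so that
    associativity and commutativity are proved for both at once. *)
Definition pl_lift (op : forall T : finComNzRingType, T -> T -> T)
    (u v : plonka) : plonka :=
  match u, v with
  | Some (inl x), Some (inl y) => pl_top (op S x y)
  | Some (inl x), Some (inr y) => pl_mid (op _ (h (tag y) x) (tagged y))
  | Some (inr x), Some (inl y) => pl_mid (op _ (tagged x) (h (tag x) y))
  | Some (inr x), Some (inr y) =>
      if tag x == tag y then pl_mid (op _ (tagged x) (tagged_as x y)) else None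
  | _, _ => None
  end.

Definition pl_opp (u : plonka) : plonka :=
  match u with
  | Some (inl x) => pl_top (- x)
  | Some (inr y) => pl_mid (- tagged y)
  | None => None
  end.

Lemma tagged_as_existT i (x y : R i) :
  tagged_as (existT (fun j => R j : Type) i x) (existT _ i y) = y.
Proof. exact: tagged_asE. Qed.

Section Lifted.

Variable op : forall T : finComNzRingType, T -> T -> T.

Lemma pl_liftC : (forall T, commutative (op (T := T))) ->
  commutative (pl_lift op).
Proof.
move=> opC [[x|[i x]]|] [[y|[j y]]|] //=; rewrite /pl_top /pl_mid /= 1?opC //.
rewrite eq_sym; case: eqP => // e; subst j.
by rewrite !tagged_as_existT opC.
Qed.

(** Both bracketings map the three arguments to the meet of their indices; as
    [op] commutes with the [h i], it does not matter whether it is applied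
    before or after. *)
Lemma pl_liftA : (forall T, associative (op (T := T))) ->
  (forall i, {morph h i : x y / op x y}) -> associative (pl_lift op).
Proof.
move=> opA op_h [[x|[i x]]|] [[y|[j y]]|] [[z|[l z]]|] //=;
  rewrite /pl_top /pl_mid /= ?op_h ?opA //=.
- by case: eqP => //= e; subst l; rewrite !tagged_as_existT opA.
- by case: eqP => //= e; subst l; rewrite !tagged_as_existT opA.
- by case: eqP => //= e; subst j; rewrite !tagged_as_existT opA.
- case: (eqVneq j l) => [e|jl] /=.
    subst l; case: eqP => //= e; subst j.
    by rewrite eqxx !tagged_as_existT opA.
  by case: eqP => //= e; subst j; rewrite (negPf jl).
- by case: ifP.
Qed.

End Lifted.

Definition pl_add := pl_lift (fun T => @GRing.add T).
Definition pl_mul := pl_lift (fun T => @GRing.mul T).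

Lemma pl_addC : commutative pl_add.
Proof. by apply: pl_liftC => T; exact: addrC. Qed.

Lemma pl_addA : associative pl_add.
Proof. by apply: pl_liftA => [T|i x y]; [exact: addrA|rewrite rmorphD]. Qed.

Lemma pl_mulC : commutative pl_mul.
Proof. by apply: pl_liftC => T; exact: mulrC. Qed.

Lemma pl_mulA : associative pl_mul.
Proof. by apply: pl_liftA => [T|i x y]; [exact: mulrA|rewrite rmorphM]. Qed.

Lemma pl_mulDr : right_distributive pl_mul pl_add.
Proof.
move=> [[x|[i x]]|] [[y|[j y]]|] [[z|[l z]]|] //=;
  rewrite /pl_mul /pl_add /pl_top /pl_mid /= ?rmorphD ?mulrDr //=.
- by rewrite rmorphM.
- by rewrite rmorphM.
- by case: (eqVneq j l) => //= e; subst l; rewrite !tagged_as_existT mulrDr.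
- by rewrite eqxx tagged_as_existT.
- case: (eqVneq i l) => //= e; subst l.
  by rewrite eqxx !tagged_as_existT mulrDr.
- case: (eqVneq i j) => //= e; subst j.
  by rewrite eqxx !tagged_as_existT mulrDr.
- case: (eqVneq j l) => [e|jl] /=.
    subst l; case: (eqVneq i j) => //= e; subst j.
    by rewrite eqxx !tagged_as_existT mulrDr.
  case: (eqVneq i j) => //= e; subst j; case: (eqVneq i l) => //= e; subst l.
  by rewrite eqxx in jl.
- by case: ifP.
Qed.

Lemma pl_addr0 : right_id (pl_top 0) pl_add.
Proof. by move=> [[x|[i x]]|] //=; rewrite /pl_add /= ?rmorph0 addr0. Qed.

Lemma pl_mul1r : left_id (pl_top 1) pl_mul.
Proof. by move=> [[x|[i x]]|] //=; rewrite /pl_mul /= ?rmorph1 mul1r. Qed.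

Lemma pl_addrN u : pl_add u (pl_opp u) = pl_mul (pl_top 0) u.
Proof.
case: u => [[x|[i x]]|] //=; rewrite /pl_mul /pl_add /=.
  by rewrite mul0r subrr.
by rewrite rmorph0 mul0r eqxx tagged_as_existT subrr.
Qed.

Lemma pl_oppK : involutive pl_opp.
Proof. by move=> [[x|[i x]]|] //=; rewrite opprK. Qed.

(** The last axiom is the instance of distributivity at zero. *)
Definition plonka_preMeadow : preMeadow :=
  PreMeadow pl_addA pl_addC pl_addr0 pl_addrN pl_mulA pl_mulC pl_mul1r
    pl_mulDr pl_oppK (pl_mulDr (pl_top 0)).

Local Notation P := plonka_preMeadow.

Lemma pl_mul0 (u : P) : pm_mul (pm_zero P) u =
  match u : plonka with
  | Some (inl _) => pl_top 0
  | Some (inr y) => pl_mid (0 : R (tag y))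
  | None => None
  end.
Proof. by case: u => [[x|[i x]]|] //=; rewrite /pl_mul /= ?rmorph0 mul0r. Qed.

Lemma pl_zeros_top : @pm_zeros P (pl_top 0).
Proof. by exists (pl_top 0) => //; exact: pl_mul0. Qed.

Lemma pl_zeros_mid i : @pm_zeros P (pl_mid (0 : R i)).
Proof. by exists (pl_mid (0 : R i)) => //; exact: pl_mul0. Qed.

Lemma pl_top_inj : injective pl_top. Proof. by move=> x y []. Qed.

Lemma pl_mid_inj i : injective (@pl_mid i).
Proof. by move=> x y [] /eqP; rewrite eq_Tagged => /eqP. Qed.

Lemma pl_fiber_top : @pm_fiber P (pl_top 0) #= `I_#|S|.
Proof.
apply/card_eq_enum; exists pl_top; first exact: pl_top_inj.
apply/seteqP; split=> [u|_ [x _ <-]]; last exact: pl_mul0.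
by rewrite /pm_fiber /mkset pl_mul0; case: u => [[x|y]|] // _; exists x.
Qed.

Lemma pl_fiber_mid i : @pm_fiber P (pl_mid (0 : R i)) #= `I_#|R i|.
Proof.
apply/card_eq_enum; exists (@pl_mid i); first exact: pl_mid_inj.
apply/seteqP; split=> [u|_ [y _ <-]]; last exact: pl_mul0.
rewrite /pm_fiber /mkset pl_mul0; case: u => [[x|[j y]]|] // [/= e].
by subst j; exists y.
Qed.

Lemma pl_fiber_bot : @pm_fiber P None #= `I_1.
Proof.
rewrite -card_unit; apply/card_eq_enum; exists (fun=> None); first by do 2 case.
apply/seteqP; split=> [u|_ [y _ <-]]; last exact: pl_mul0.
by rewrite /pm_fiber /mkset pl_mul0; case: u => [[x|y]|] // _; exists tt.
Qed.

(** Nonzero rings have more than one element, so the bottom is the only point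
    whose fibre is a singleton. *)
Lemma pl_bot_unique :
  unique (fun z : P => pm_zeros z /\ pm_fiber z #= `I_1) None.
Proof.
split; first by split; [exists None|exact: pl_fiber_bot].
move=> z [] [u _ <-]; rewrite pl_mul0; case: u => [[x|[i y]]|] // [].
  rewrite (card_eql pl_fiber_top) => /card_eq_II e.
  by have := card_finNzRing_gt1 S; rewrite e.
rewrite (card_eql (pl_fiber_mid i)) => /card_eq_II e.
by have := card_finNzRing_gt1 (R i); rewrite e.
Qed.

Lemma pl_addrbot (u : P) : pm_add u None = None.
Proof. by case: u => [[x|y]|]. Qed.

Definition plonka_preMeadowWithA : preMeadowWithA :=
  PreMeadowWithA pl_bot_unique pl_addrbot.

Lemma card_plonka : #|plonka| = (#|S| + \sum_i #|R i|).+1%N.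
Proof.
by rewrite card_option card_sum card_tagged sumnE big_map big_enum.
Qed.

End PlonkaSum.

(** * Fibres of a pre-meadow *)

Section PreMeadowTheory.

Variable M : preMeadow.
Local Notation "x + y" := (pm_add x y).
Local Notation "x * y" := (pm_mul x y).
Local Notation "0" := (pm_zero M).
Local Notation "1" := (pm_one M).
Implicit Types x y z : M.

Lemma pm_mulDl x y z : (x + y) * z = x * z + y * z.
Proof. by rewrite pm_mulC pm_mulDr !(pm_mulC z). Qed.

Lemma pm_addr_mul0 x : x + 0 * x = x.
Proof. by rewrite -{1}(pm_mul1r x) -pm_mulDl pm_addr0 pm_mul1r. Qed.

Lemma pm_mul00 : 0 * 0 = 0.
Proof. by have := pm_addr_mul0 0; rewrite pm_addC pm_addr0. Qed.

Lemma pm_mul01 : 0 * 1 = 0.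
Proof. by rewrite pm_mulC pm_mul1r. Qed.

Lemma pm_mul0_opp1 : 0 * pm_opp 1 = 0.
Proof.
have := pm_mul0D 1 (pm_opp 1).
by rewrite pm_addrN pm_mul01 pm_mul00 pm_addC pm_addr0 => <-.
Qed.

Lemma pm_zerosP z : pm_zeros z <-> 0 * z = z.
Proof. by split=> [[x _ <-]|]; [rewrite pm_mulA pm_mul00|exists z]. Qed.

(** The fibre of [z] is an additive group with zero [z], the opposite of [u]
    being [(-1) * u]; the group is transported to an ordinal type, so that
    the theorems of Lagrange and Cauchy can be applied to it. *)
Lemma fiber_group (z : M) (c : nat) : pm_zeros z -> pm_fiber z #= `I_c ->
  exists (G : finGroupType) (g : G -> M),
    [/\ #|G| = c, pm_fiber z = range g, injective g, g 1%g = z &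
        forall u v, g (u * v)%g = g u + g v].
Proof.
move=> /pm_zerosP z0; rewrite -{1}(card_ord c) => /card_eq_enum[g g_inj Eg].
have g0 u : 0 * g u = z.
  by have : pm_fiber z (g u) by rewrite Eg; exists u.
have [|inv_g gK] := @choice {x | pm_fiber z x} 'I_c (fun w u => g u = sval w).
  by case=> x /= xz; move: (xz); rewrite {1}Eg => -[u _ gu]; exists u.
have mulP u v : pm_fiber z (g u + g v).
  by rewrite /pm_fiber /mkset pm_mul0D !g0 -{2}z0 pm_addr_mul0.
have invP u : pm_fiber z (pm_opp 1 * g u).
  by rewrite /pm_fiber /mkset pm_mulA pm_mul0_opp1.
pose mul u v := inv_g (exist _ _ (mulP u v)).
pose inv u := inv_g (exist _ _ (invP u)).
pose one := inv_g (exist _ z z0).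
have gM u v : g (mul u v) = g u + g v by rewrite gK.
have g1 : g one = z by rewrite gK.
have mulA : associative mul.
  by move=> u v w; apply: g_inj; rewrite !gM pm_addA.
have mul1 : left_id one mul.
  by move=> u; apply: g_inj; rewrite gM g1 pm_addC -(g0 u) pm_addr_mul0.
have mulV : left_inverse one inv mul.
  move=> u; apply: g_inj; rewrite gM gK /= g1 -{2}(pm_mul1r (g u)) -pm_mulDl.
  by rewrite pm_addC pm_addrN pm_mul01 g0.
pose G : finGroupType :=
  HB.pack 'I_c (Finite_isGroup.Build 'I_c mulA mul1 mulV).
by exists G, g; split=> //; exact: card_ord.
Qed.

(** The multiple starts from [0 * x], the zero of the fibre of [x], instead of
    [0], so that it stays in that fibre for [m = 0]. *)
Definition pm_natmul (m : nat) x := iter m (pm_add x) (0 * x).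

Lemma pm_natmulE m x : pm_natmul m x = pm_natmul m 1 * x.
Proof.
elim: m => [|m IH]; first by rewrite /pm_natmul /= pm_mul01.
by rewrite /pm_natmul !iterS pm_mulDl pm_mul1r -IH.
Qed.

(** By Lagrange [b] times [1] vanishes in the fibre of [0], hence [b] times any
    [u] in the fibre of [z] is [0 * u = z].  Cauchy provides some [u] of order
    [q], and [q] divides every exponent killing [u]. *)
Lemma fiber_prime_dvd (z : M) (a b q : nat) : pm_zeros z ->
  pm_fiber z #= `I_a -> pm_fiber 0 #= `I_b ->
  prime q -> q %| a -> q %| b.
Proof.
have zeros0 : pm_zeros 0 by apply/pm_zerosP; exact: pm_mul00.
have gX (G : finGroupType) (g : G -> M) y u m : pm_fiber y = range g ->
    g 1%g = y -> (forall u v, g (u * v)%g = g u + g v) ->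
    g (u ^+ m)%g = pm_natmul m (g u).
  move=> Eg g1 gM; elim: m => [|m IH]; last by rewrite expgS gM IH.
  have: pm_fiber y (g u) by rewrite Eg; exists u.
  by rewrite /pm_natmul /= => ->.
move=> zz /(fiber_group zz)[G [g [cG Eg g_inj g1 gM]]].
move=> /(fiber_group zeros0)[H [k [cH Ek _ k1 kM]]] q_pr q_a.
have b1 : pm_natmul b 1 = 0.
  have : pm_fiber 0 1 by exact: pm_mul01.
  rewrite Ek => -[u _ <-]; rewrite -(gX _ _ _ _ _ Ek) // -cH -cardsT.
  by rewrite expg_cardG ?inE.
have [|u _ <-] := @Cauchy G q [set: G]%G q_pr; first by rewrite cardsT cG.
rewrite order_dvdn; apply/eqP/g_inj; rewrite (gX _ _ _ _ _ Eg) // pm_natmulE b1.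
by have : pm_fiber z (g u) by [rewrite Eg; exists u]; rewrite g1.
Qed.

End PreMeadowTheory.

(** * Admissible partitions and pre-meadows *)

(** The fibres of the [x_i] are disjoint and have [n - 1] elements in all.  Both
    [0] and [a] would lie outside them if [0] were none of the [x_i], and
    [0 <> a] since otherwise [M] would be reduced to [a]. *)
Lemma associated_zero (n : nat) (p : seq nat) (M : preMeadowWithA) (s : nat)
    (a : 'I_s.+1 -> nat) (x : 'I_s.+1 -> M) :
  3 <= n -> sumn p = n -> [set: M] #= `I_n -> partition_form p a ->
  (forall i, (@pm_zeros M `\ pma_a M) (x i)) ->
  (forall i, pm_fiber (x i) #= `I_(a i)) ->
  (forall i j, i != j -> pm_fiber (x i) <> pm_fiber (x j)) ->
  exists k, x k = pm_zero M.
Proof.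
move=> n3 sump cM pa xz cx xx; apply: contrapT => no_k.
have fib : forall i, exists g : 'I_(a i) -> M,
    injective g /\ pm_fiber (x i) = range g.
  move=> i; have := cx i; rewrite -{1}(card_ord (a i)).
  by move=> /card_eq_enum[g ? ?]; exists g.
have [g gP] := fin_all_exists fib.
have g0 i u : pm_mul (pm_zero M) (g i u) = x i.
  by have [_ E] := gP i; have : pm_fiber (x i) (g i u) by rewrite E; exists u.
have x_inj i j : x i = x j -> i = j.
  by move=> e; apply/eqP; apply: contrapT => /negP /xx; rewrite e.
have /pm_zerosP a0 : pm_zeros (pma_a M) by case: (pma_aP M) => -[].
have zero_neq_a : pm_zero M <> pma_a M.
  move=> za; have all0 y : y = pma_a M.
    by have := pma_addra y; rewrite -{1}za pm_addr0.
  have /card_eq_enum[e e_inj _] : [set: M] #= `I_#|'I_n| by rewrite card_ord.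
  have tt_inj : injective (fun _ : 'I_n => tt).
    by move=> i j _; apply: e_inj; rewrite (all0 (e i)) (all0 (e j)).
  have := leq_card _ tt_inj.
  by rewrite card_ord card_unit leqNgt (ltnW n3).
pose f (u : option (option {i & 'I_(a i)})) : M :=
  match u with
  | Some (Some iu) => g (tag iu) (tagged iu)
  | Some None => pma_a M
  | None => pm_zero M
  end.
have f_inj : injective f.
  have gz i u : g i u <> pm_zero M.
    by move=> e; apply: no_k; exists i; rewrite -(g0 i u) e pm_mul00.
  have ga i u : g i u <> pma_a M.
    by move=> e; have [_ /=] := xz i; rewrite -(g0 i u) e a0.
  move=> [[[i u]|]|] [[[j v]|]|] //= e; try by [
    case: (gz _ _ e)|case: (ga _ _ e)|case: (gz _ _ (esym e))|
    case: (ga _ _ (esym e))|case: zero_neq_a].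
  have ij : i = j by apply: x_inj; rewrite -(g0 i u) e g0.
  by subst j; have [g_inj _] := gP i; rewrite (g_inj _ _ e).
have: `I_#|{: option (option {i & 'I_(a i)})}| #<= `I_n.
  rewrite -(card_le_eqr cM).
  have : range f #= `I_#|{: option (option {i & 'I_(a i)})}|.
    by apply/card_eq_enum; exists f.
  by move=> /card_le_eql <-; exact: card_leT.
rewrite card_le_II !card_option card_tagged -sump (perm_sumn pa) sumn_rcons.
by rewrite (eq_map (fun i => card_ord (a i))) addn1 ltnn.
Qed.

Lemma admissible_of_associated (n : nat) (p : seq nat) (M : preMeadowWithA) :
  3 <= n -> sumn p = n -> associated n p M -> admissible p.
Proof.
move=> n3 sump [cM [s [a [x [pa xz cx xx]]]]].
have [k xk] := associated_zero n3 sump cM pa xz cx xx.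
exists s, a; split=> // [i|]; last first.
  exists k => i q; apply: fiber_prime_dvd (cx i) _; first by have [] := xz i.
  by rewrite -xk; exact: cx.
have [zxi xi_neq_a] := xz i.
case: (a i) (cx i) => [|[|//]] c.
  have : pm_fiber (x i) (x i) by apply/pm_zerosP.
  by move: c; rewrite II0 card_eq0 => /eqP ->.
by have [_ a_uniq] := pma_aP M; case: xi_neq_a; rewrite (a_uniq (x i)).
Qed.

(** The ring of order [a_k] goes on top; the other parts are indexed by ['I_s]
    through [lift k]. *)
Lemma associated_of_admissible (n : nat) (p : seq nat) :
  sumn p = n -> admissible p -> exists M : preMeadowWithA, associated n p M.
Proof.
move=> sump [s [a [pa a_gt1 [k ak]]]].
have [|S [cS _ StoF]] := @ring_of_order int (a k) (a_gt1 k).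
  by move=> q _ _; exact: (inhabits (intr : {rmorphism int -> 'F_q})).
have : forall i : 'I_s, exists R : finComNzRingType,
    #|R| = a (lift k i) /\ inhabited {rmorphism S -> R}.
  move=> i; have := @ring_of_order S _ (a_gt1 (lift k i)).
  move=> [q q_pr q_a|R [cR h _]].
    by apply: StoF => //; exact: ak q_a.
  by exists R.
move=> /fin_all_exists[R RP].
have cR i : #|R i| = a (lift k i) by case: (RP i).
have /fin_all_exists[h _] : forall i, exists h : {rmorphism S -> R i}, True.
  by move=> i; have [_ [h]] := RP i; exists h.
pose M := plonka_preMeadowWithA h.
exists M; split.
  have cM : #|plonka S R| = n.
    rewrite card_plonka cS -sump (perm_sumn pa) sumn_rcons addn1.
    congr _.+1; rewrite (eq_bigr _ (fun i _ => cR i)) sumnE big_image /=.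
    by rewrite (bigD1_ord k).
  rewrite -cM; apply/card_eq_enum; exists id => //.
  by rewrite image_id.
pose x i : M :=
  if unlift k i is Some j then pl_mid S (0 : R j)%R else pl_top R (0 : S)%R.
have xz i : pm_zeros (x i).
  rewrite /x; case: (unlift k i) => [j|]; first exact: pl_zeros_mid.
  exact: pl_zeros_top.
exists s, a, x; split=> // [i|i|i j].
- split; first exact: xz.
  by rewrite /x /=; case: (unlift k i) => [j|] //.
- rewrite /x; case: unliftP => [j|] ->.
    by rewrite -cR; exact: pl_fiber_mid.
  by rewrite -cS; exact: pl_fiber_top.
move=> /eqP ij e; apply: ij.
have : x i = x j.
  have /pm_zerosP <- := xz i.
  by have : pm_fiber (x j) (x i) by rewrite -e; apply/pm_zerosP.
rewrite /x; case: unliftP => [i' ->|->].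
  by case: unliftP => [j' ->|->] // [] /= ->.
by case: unliftP => [j' _|->].
Qed.

Theorem theorem3p11 (n : nat) (p : seq nat) (hn : 3 <= n)
    (hp : nat_partition n p) :
  admissible p <-> exists M : preMeadowWithA, associated n p M.
Proof.
have [_ _ sump] := hp; split=> [/(associated_of_admissible sump) //|[M]].
exact: admissible_of_associated.
Qed.
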